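(* Let $G=(\mathcal{V},\mathcal{E})$ be a finite graph with $C\ge 2$ classes, in which every node $i$ has a true label $y_i\in\{1,\dots,C\}$, a feature vector $\mathbf{x}_i\in\mathbb{R}^F$, and degree $deg(i)\ge 1$; write $\mathcal{N}(i)$ for the set of neighbours of $i$. Assume: (1) the feature $\mathbf{x}_i$ of each node $i$ is sampled from a distribution $\mathcal{D}_{y_i}$ depending only on its label, with mean $\boldsymbol{\mu}(y_i)$, features of distinct nodes being drawn independently given the labels; (2) the coordinates of $\mathbf{x}_i$ are independent; (3) $\max_k|\mathbf{x}_i[k]|\le B$ for a positive scalar $B$; (4) the (pseudo-)label vector $\hat{\mathbf{y}}_i$ satisfies $\mathbb{E}[\hat{\mathbf{y}}_i]=(1-\epsilon)\mathbf{e}_{y_i}+\frac{\epsilon}{C-1}\sum_{j\ne y_i}\mathbf{e}_j$ for some $\epsilon\in(0,1)$; (5) given $y_i$, the labels $\{y_j: j\in\mathcal{N}(i)\}$ of the neighbours of $i$ are conditionally independent, each equal to $y_i$ with probability $p$ and equal to any given class $c\ne y_i$ with probability $(1-p)/(C-1)$. Define the mixed feature of node $i$ after one Mixup operation by $\mathbf{h}_i=\sum_{j\in\mathcal{N}(i)}\frac{1}{deg(i)}\mathbf{x}_j$. Then, for any node $i\in\mathcal{V}$ (expectations and probabilities being conditional on $y_i$), $$\mathbb{E}[\mathbf{h}_i]=p\,\boldsymbol{\mu}(y_i)+\frac{1-p}{C-1}\sum_{c\ne y_i}\boldsymbol{\mu}(c),$$ and for every $t>0$, $$\mathbb{P}\big(\|\mathbf{h}_i-\mathbb{E}[\mathbf{h}_i]\|_2\ge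 t\big)\le 2F\exp\!\Big(-\frac{deg(i)\,t^2}{2B^2F}\Big).$$
   Context: $\mathbf{e}_c$ denotes the $c$-th standard basis vector of $\mathbb{R}^C$; $\mathbf{x}[k]$ denotes the $k$-th coordinate of a vector $\mathbf{x}$; $F$ is the feature dimension. The Mixup operation replaces a node's feature by the weighted average of its neighbours' features. *)

(* Defs.v *)
From HB Require Import structures.
From mathcomp Require Import all_boot all_order all_algebra.
From mathcomp Require Import all_classical all_reals all_analysis.
Set Implicit Arguments. Unset Strict Implicit. Unset Printing Implicit Defensive.
Import Order.TTheory GRing.Theory Num.Theory.
Local Open Scope classical_set_scope.
Local Open Scope ring_scope.

Definition nbhd (V : finType) (e : rel V) (i : V) : {set V} := [set j | e i j].
Definition deg (V : finType) (e : rel V) (i : V) : nat := #|nbhd e i|.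

Definition label_event (V : finType) (C : nat) (T : Type) (Y : V -> T -> 'I_C)
  (S : pred V) (l : V -> 'I_C) : set T :=
  [set w | forall v, S v -> Y v w = l v].

Definition feature_event (V : finType) (F : nat) (R : realType) (T : Type)
  (X : V -> 'I_F -> T -> R) (A : V -> 'I_F -> set R) : set T :=
  [set w | forall v k, A v k (X v k w)].

Definition mixup (V : finType) (F : nat) (R : realType) (T : Type) (e : rel V)
  (X : V -> 'I_F -> T -> R) (i : V) (w : T) (k : 'I_F) : R :=
  \sum_(j in nbhd e i) (deg e i)%:R^-1 * X j k w.

Definition mean (R : realType) (D : probability R R) : R :=
  fine ('E_D[fun x : R => x])%E.

(* Main.v *)
(** Conditionally on all the labels the features are independent; since the labels of the
    neighbours of a node are themselves independent, the [k]-th coordinates of the neighbours'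
    features are unconditionally independent, each distributed as the mixture of the laws
    [D c k] weighted by the label probabilities. This gives the mean of the mixed feature, and
    Hoeffding's inequality for each coordinate at level [t / sqrt F], followed by a union bound
    over the [F] coordinates, gives the tail estimate. *)
Require Import Defs.
From HB Require Import structures.
From mathcomp Require Import all_boot all_order all_algebra.
From mathcomp Require Import all_classical all_reals all_analysis measurable_realfun.
From mathcomp Require Import ring lra.
Set Implicit Arguments. Unset Strict Implicit. Unset Printing Implicit Defensive.
Import Order.TTheory GRing.Theory Num.Theory numFieldNormedType.Exports.
Local Open Scope classical_set_scope.
Local Open Scope ring_scope.

Import HBNNSimple.

(** * Integrals of products of independent variables *)

(** Agreement on indicators extends to simple functions by linearity, then to nonnegative measurable
    functions by monotone convergence. The weights allow both a conditional change of variables and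
    the exchange of one factor in a product. *)
Lemma ge0_integral_transfer (R : realType) (d d1 d2 : measure_display)
  (S : measurableType d) (T1 : measurableType d1) (T2 : measurableType d2)
  (m1 : {measure set T1 -> \bar R}) (m2 : {measure set T2 -> \bar R})
  (Z1 : T1 -> R) (Z2 : T2 -> R) (X1 : T1 -> S) (X2 : T2 -> S) :
  measurable_fun setT Z1 -> measurable_fun setT Z2 ->
  measurable_fun setT X1 -> measurable_fun setT X2 ->
  (forall w, 0 <= Z1 w) -> (forall w, 0 <= Z2 w) ->
  (forall A, measurable A ->
    (\int[m1]_w (Z1 w * \1_A (X1 w))%:E = \int[m2]_w (Z2 w * \1_A (X2 w))%:E)%E) ->
  forall f : S -> \bar R, measurable_fun setT f -> (forall x, 0 <= f x)%E ->
  (\int[m1]_w ((Z1 w)%:E * f (X1 w)) = \int[m2]_w ((Z2 w)%:E * f (X2 w)))%E.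
Proof.
move=> mZ1 mZ2 mX1 mX2 Z10 Z20 ZA f mf f0.
pose h := nnsfun_approx measurableT mf.
have limE d' (T : measurableType d') (m : {measure set T -> \bar R})
    (Z : T -> R) (X : T -> S) : measurable_fun setT Z ->
    measurable_fun setT X -> (forall w, 0 <= Z w) ->
    (\int[m]_w ((Z w)%:E * f (X w)) =
     limn (fun n => \int[m]_w ((Z w)%:E * (h n (X w))%:E)))%E.
  move=> mZ mX Z0.
  rewrite -monotone_convergence//=.
  - apply: eq_integral => w _; apply/esym/cvg_lim => //.
    by apply: cvgeZl => //; exact: cvg_nnsfun_approx.
  - move=> n; apply: emeasurable_funM; apply/measurable_EFinP => //.
    exact: measurableT_comp.
  - by move=> n w _; rewrite mule_ge0 ?lee_fin.
  - move=> w _ m' n mn; rewrite lee_wpmul2l ?lee_fin//.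
    exact/lefP/nd_nnsfun_approx.
rewrite !limE//; congr (limn _); apply/funext => n.
have simpleE d' (T : measurableType d') (m : {measure set T -> \bar R})
    (Z : T -> R) (X : T -> S) : measurable_fun setT Z ->
    measurable_fun setT X -> (forall w, 0 <= Z w) ->
    (\int[m]_w ((Z w)%:E * (h n (X w))%:E) =
     \sum_(y \in range (h n)) (y%:E * \int[m]_w ((Z w * \1_(h n @^-1` [set y]) (X w))%:E)))%E.
  move=> mZ mX Z0.
  have mi y : measurable_fun setT (fun w => (Z w * \1_(h n @^-1` [set y]) (X w))%:E).
    apply/measurable_EFinP/measurable_funM => //.
    exact: (measurableT_comp (f := (\1_(h n @^-1` [set y]) : S -> R))).
  have i0 y w : (0 <= (Z w * \1_(h n @^-1` [set y]) (X w))%:E)%E.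
    by rewrite lee_fin mulr_ge0.
  (* [Num.max y 0] makes every summand nonnegative, not only those with [y] in the range. *)
  transitivity (\int[m]_w (\sum_(y \in range (h n))
      ((Num.max y 0)%:E * (Z w * \1_(h n @^-1` [set y]) (X w))%:E)))%E.
    apply: eq_integral => w _.
    rewrite fimfunE -EFinM.
    under [RHS]eq_fsbigr do rewrite -EFinM.
    rewrite fsumEFin// mulr_fsumr//.
    congr (_%:E); apply: eq_fsbigr => y.
    rewrite inE => -[x _ <-].
    by rewrite max_l// mulrCA.
  rewrite ge0_integral_fsum//; last 2 first.
  - by move=> y; exact: measurable_funeM.
  - by move=> y w _; rewrite mule_ge0// lee_fin le_max lexx orbT.
  apply: eq_fsbigr => y; rewrite inE => -[x _ <-].
  rewrite max_l// ge0_integralZl// lee_fin//.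
by rewrite !simpleE//; apply: eq_fsbigr => y _; rewrite ZA.
Qed.

(** Independence is known on rectangles, that is, for products of indicators. General factors are
    introduced one index at a time, each through [ge0_integral_transfer] with the other factors as
    weight. *)
Lemma integral_prod_independent (R : realType) (d d' : measure_display)
  (T : measurableType d) (S : measurableType d')
  (P : probability T R) (I : finType) (N : {set I}) (X : I -> T -> S) :
  (forall i, measurable_fun setT (X i)) ->
  (forall A : I -> set S, (forall i, measurable (A i)) ->
     P [set w | forall i, i \in N -> A i (X i w)] =
     (\prod_(i in N) P (X i @^-1` A i))%E) ->
  forall f : I -> S -> R, (forall i, measurable_fun setT (f i)) ->
  (forall i x, 0 <= f i x) ->
  (forall i, \int[P]_w (f i (X i w))%:E \is a fin_num)%E ->
  (\int[P]_w (\prod_(i in N) f i (X i w))%:E =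
   \prod_(i in N) \int[P]_w (f i (X i w))%:E)%E.
Proof.
move=> mX indep.
have mXA i (A : set S) : measurable A -> measurable (X i @^-1` A).
  by move=> mA; rewrite -[X in measurable X]setTI; exact: mX.
have intA i (A : set S) : measurable A ->
    (\int[P]_w (\1_A (X i w))%:E = P (X i @^-1` A))%E.
  move=> mA; rewrite -[X in _ = P X]setIT -integral_indic//; exact: mXA.
(* Generalization for the induction: [s] lists the indices where [f i] may be other than an
   indicator. With [s = enum I] the extra condition is vacuous. *)
suff H (s : seq I) (f : I -> S -> R) : (forall i, measurable_fun setT (f i)) ->
    (forall i x, 0 <= f i x) ->
    (forall i, \int[P]_w (f i (X i w))%:E \is a fin_num)%E ->
    (forall i, i \notin s -> exists2 A, measurable A & f i = \1_A) ->
    (\int[P]_w (\prod_(i in N) f i (X i w))%:E =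
     \prod_(i in N) \int[P]_w (f i (X i w))%:E)%E.
  by move=> f mf f0 ffin; apply: (H (enum I)) => // i; rewrite mem_enum.
elim: s f => [|a s IH] f mf f0 ffin fs.
  have /choice[A AP] i : exists A, measurable A /\ f i = \1_A.
    by have [//|A ? ?] := fs i; exists A.
  transitivity (P [set w | forall i, i \in N -> A i (X i w)]).
    rewrite -[X in _ = P X]setIT -integral_indic//; last first.
      rewrite (_ : [set w | _] = \bigcap_(i in [set` N]) (X i @^-1` A i)); last first.
        by apply/seteqP; split.
      apply: fin_bigcap_measurable; first exact: finite_finset.
      by move=> i _; apply: mXA; exact: (AP i).1.
    apply: eq_integral => w _; congr (_%:E).
    rewrite indicE.
    under eq_bigr do rewrite (AP _).2 indicE.
    have [h|h] := pselect (forall i, i \in N -> A i (X i w)).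
      by rewrite mem_set//; apply: big1 => i iN; rewrite mem_set//; exact: h.
    have /existsNP[i /not_implyP[iN nA]] := h.
    by rewrite memNset// (bigD1 i)//= memNset// mul0r.
  rewrite indep; last by move=> i; exact: (AP i).1.
  apply: eq_bigr => i _.
  by rewrite (AP i).2 intA//; exact: (AP i).1.
(* For [a] outside [N] the factor [f a] does not occur in the product; turning the factors outside
   [N] into indicators of the whole space makes the induction hypothesis applicable. *)
have [aN|aN] := boolP (a \in N); last first.
  pose g i := if i \in N then f i else \1_setT.
  have gE i : i \in N -> g i = f i by rewrite /g => ->.
  transitivity (\int[P]_w (\prod_(i in N) g i (X i w))%:E)%E.
    by apply: eq_integral => w _; congr (_%:E); apply: eq_bigr => i /gE ->.
  rewrite IH; first by apply: eq_bigr => i /gE ->.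
  - by move=> i; rewrite /g; case: ifP.
  - by move=> i x; rewrite /g; case: ifP.
  - move=> i; rewrite /g; case: ifP => // _.
    by rewrite intA// fin_num_measure//; exact: mXA.
  - move=> i nis; rewrite /g; case: ifP => iN; last by exists setT.
    apply: fs; rewrite inE negb_or nis andbT; apply: contraNneq aN => <-.
    by [].
(* The factor at [a] is split off: the claim becomes that the weight [Z] may be replaced by the
   constant [c] against any function of [X a]. By the transfer lemma it suffices to test indicators,
   and there the induction hypothesis applies. *)
pose Z w := \prod_(i in N | i != a) f i (X i w).
pose c := (\prod_(i in N | i != a) \int[P]_w (f i (X i w))%:E)%E.
have c0 : (0 <= c)%E.
  by apply: prode_ge0 => i _; apply: integral_ge0 => w _; rewrite lee_fin.
have cE : c = (fine c)%:E by rewrite fineK// prode_fin_num.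
rewrite (bigD1 a)//= -/c muleC cE -ge0_integralZl ?lee_fin ?fine_ge0//; last 2 first.
- by apply/measurable_EFinP; exact: measurableT_comp.
- by move=> w _; rewrite lee_fin.
under [LHS]eq_integral => w _ do rewrite (bigD1 a)//= mulrC EFinM.
have mZ : measurable_fun setT Z.
  rewrite /Z; under eq_fun do rewrite -big_filter.
  by apply: measurable_prod => i _; exact: measurableT_comp.
have Z0 w : 0 <= Z w by apply: prodr_ge0.
apply: (@ge0_integral_transfer R _ _ _ _ _ _ P P Z (cst (fine c)) (X a) (X a) _ _ _ _ _ _ _ (EFin \o f a)) => //=.
- by move=> w; rewrite fine_ge0.
- move=> A mA.
  pose g i := if i == a then \1_A : S -> R else f i.
  have gE i : i != a -> g i = f i by rewrite /g => /negPf ->.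
  have ga : g a = \1_A by rewrite /g eqxx.
  have -> : (\int[P]_w (Z w * \1_A (X a w))%:E =
             \int[P]_w (\prod_(i in N) g i (X i w))%:E)%E.
    apply: eq_integral => w _; congr (_%:E).
    rewrite [RHS](bigD1 a)//= ga mulrC; congr (_ * _).
    by apply: eq_bigr => i /andP[_ /gE ->].
  rewrite IH.
  + rewrite (bigD1 a)//= ga.
    under eq_bigr => i /andP[_ /gE gi] do rewrite gi.
    rewrite -/c muleC cE; under [RHS]eq_integral do rewrite EFinM.
    rewrite ge0_integralZl//; last by rewrite lee_fin/= fine_ge0.
    by apply/measurable_EFinP; exact: (measurableT_comp (f := (\1_A : S -> R))).
  + by move=> i; rewrite /g; case: ifP.
  + by move=> i x; rewrite /g; case: ifP.
  + move=> i; rewrite /g; case: ifP => // _.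
    by rewrite intA// fin_num_measure//; exact: mXA.
  + move=> i nis; rewrite /g; case: ifP => ia; first by exists A.
    by apply: fs; rewrite inE negb_or nis ia.
- exact/measurable_EFinP.
- by move=> x; rewrite lee_fin.
Qed.

(** * Hoeffding's inequality *)

(** Convexity of the exponential: [x] is the convex combination of [- B] and [B] with these two
    weights. *)
Lemma expR_chord (R : realType) (B l x : R) : 0 < B -> `|x| <= B ->
  expR (l * x) <= (B - x) / (2 * B) * expR (- (l * B)) + (B + x) / (2 * B) * expR (l * B).
Proof.
move=> B0 xB.
have /andP[xB1 xB2] : - B <= x <= B by rewrite -ler_norml.
have B20 : 0 < 2 * B by rewrite mulr_gt0.
have t0 : 0 <= (B - x) / (2 * B) by rewrite divr_ge0 ?subr_ge0// ltW.
have t1 : (B - x) / (2 * B) <= 1 by rewrite ler_pdivrMr// mul1r; lra.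
have := @convex_expR R (Itv01 t0 t1) (- (l * B)) (l * B).
rewrite !convRE/= /unstable.onem.
set u := _ + _ * (l * B); have -> : u = l * x.
  by rewrite /u; field; rewrite gt_eqF.
move=> /le_trans; apply.
rewrite (_ : 1 - _ = (B + x) / (2 * B))//.
by field; rewrite gt_eqF.
Qed.

(* With [g u = cosh u + a sinh u], the ratio [r = g'/g] satisfies the Riccati equation
   [r' = 1 - r^2 <= 1], so [r u <= a + u]. *)
Lemma cosh_sinh_le_expR (R : realType) (a u : R) : `|a| <= 1 -> 0 <= u ->
  (1 - a) / 2 * expR (- u) + (1 + a) / 2 * expR u <= expR (a * u + u ^+ 2 / 2).
Proof.
move=> a1 u0.
have /andP[a11 a12] : - 1 <= a <= 1 by rewrite -ler_norml.
pose c : R := (1 - a) / 2; pose b := (1 + a) / 2.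
have c0 : 0 <= c by rewrite /c; lra.
have b0 : 0 <= b by rewrite /b; lra.
have cb : c + b = 1 by rewrite /c /b; lra.
have ba : b - c = a by rewrite /c /b; lra.
pose g x : R := c * expR (- x) + b * expR x.
pose g' x : R := b * expR x - c * expR (- x).
have g_gt0 x : 0 < g x.
  have y0 := expR_gt0 x; have z0 := expR_gt0 (- x).
  (* Since [c + b = 1], at least one of the two coefficients is positive, which gives strict
     positivity even when [a] is [1] or [- 1]. *)
  have [c12|c12] := leP c (1 / 2).
    by apply: ltr_wpDl; rewrite ?mulr_ge0 ?mulr_gt0//; lra.
  by apply: ltr_pwDl; rewrite ?mulr_ge0 ?mulr_gt0//; lra.
have dg (x : R) : is_derive x 1 g (g' x).
  apply: is_derive_eq. rewrite /g' /GRing.scale/=; ring.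
have dg' (x : R) : is_derive x 1 g' (g x).
  apply: is_derive_eq. rewrite /g /GRing.scale/=; ring.
pose r x := x + a - g' x / g x.
have dr (x : R) : is_derive x 1 r ((g' x / g x) ^+ 2).
  have gx0 : g x != 0 by rewrite gt_eqF.
  apply: is_derive_eq. rewrite /GRing.scale/=. by field.
have mono (f f' : R -> R) : (forall x : R, is_derive x 1 f (f' x)) ->
    (forall x, 0 <= x -> 0 <= f' x) -> forall x, 0 <= x -> f 0 <= f x.
  move=> df f'0 x x0.
  apply: (@ger0_derive1_ndecry _ f 0) => // [y|].
  - rewrite in_itv/= andbT => y0; rewrite derive1E; have [_ ->] := df y.
    exact/f'0/ltW.
  - apply: continuous_subspaceT => z.
    apply/differentiable_continuous/derivable1_diffP.
    by case: (df z).
have r0 x : 0 <= x -> 0 <= r x.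
  move=> x0; have := mono _ _ dr (fun y _ => sqr_ge0 _) _ x0.
  rewrite /r /g /g' oppr0 expR0 !mulr1 cb ba; lra.
(* The sign makes [q] nondecreasing, its derivative being a positive factor times [r]. Comparing
   with [q 0 = - 1] gives the bound on [g]. *)
pose q x := - (g x * expR (- (a * x + x ^+ 2 / 2))).
have dq (x : R) : is_derive x 1 q (g x * expR (- (a * x + x ^+ 2 / 2)) * r x).
  have gx0 : g x != 0 by rewrite gt_eqF.
  apply: is_derive_eq. rewrite /r /GRing.scale/=. by field.
have := mono _ _ dq _ _ u0.
rewrite /q {2}/g oppr0 mulr0 expr0n/= mul0r addr0 oppr0 expR0 !mulr1 cb.
move=> h; have /h : forall x, 0 <= x ->
    0 <= g x * expR (- (a * x + x ^+ 2 / 2)) * r x; last first.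
  by rewrite lerN2 expRN ler_pdivrMr ?expR_gt0// mul1r.
by move=> x x0; rewrite !mulr_ge0 ?r0// ltW.
Qed.

Lemma bounded_integrable_EFin (R : realType) (d : measure_display) (T : measurableType d)
  (P : probability T R) (X : T -> R) (B : R) :
  measurable_fun setT X -> (forall w, `|X w| <= B) ->
  P.-integrable setT (EFin \o X).
Proof.
move=> mX XB; apply: measurable_bounded_integrable => //.
  by rewrite fin_num_fun_lty//; exact: fin_num_measure.
exists B; split; first exact: num_real.
by move=> x Bx w _ /=; rewrite (le_trans (XB w))// ltW.
Qed.

(** Hoeffding's lemma without centring. Integrating the chord bound leaves an expression that
    depends on [X] only through its mean, and [cosh_sinh_le_expR] with [a = m / B] and [u = l * B]
    bounds it. *)
Lemma integral_expR_le (R : realType) (d : measure_display) (T : measurableType d)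
  (P : probability T R) (X : T -> R) (B m l : R) :
  measurable_fun setT X -> 0 < B -> (forall w, `|X w| <= B) ->
  (\int[P]_w (X w)%:E = m%:E)%E -> 0 <= l ->
  (\int[P]_w (expR (l * X w))%:E <= (expR (l * m + (l * B) ^+ 2 / 2))%:E)%E.
Proof.
move=> mX B0 XB Xm l0.
have iX := bounded_integrable_EFin P mX XB.
have mB : `|m| <= B.
  rewrite -lee_fin -abse_EFin -Xm (le_trans (le_abse_integral _ _ _))//.
    exact/measurable_EFinP.
  rewrite -[leRHS]mule1 -(@probability_setT _ _ _ P) -integral_cst//.
  apply: ge0_le_integral => //=.
  - by apply/measurable_EFinP; exact: measurableT_comp.
  - by move=> w _; rewrite lee_fin.
(* Intercept [al] and slope [be] of the chord in [expR_chord]. *)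
pose al := (expR (- (l * B)) + expR (l * B)) / 2.
pose be := (expR (l * B) - expR (- (l * B))) / (2 * B).
have B_neq0 : B != 0 by rewrite gt_eqF.
have -> : (expR (l * m + (l * B) ^+ 2 / 2) = expR (m / B * (l * B) + (l * B) ^+ 2 / 2))%R.
  by congr expR; field.
apply: (@le_trans _ _ (al + be * m)%:E); last first.
  rewrite lee_fin (le_trans _ (cosh_sinh_le_expR _ _))//.
  - by rewrite le_eqVlt; apply/orP; left; apply/eqP; rewrite /al /be; field.
  - by rewrite normrM normfV (gtr0_norm B0) ler_pdivrMr// mul1r.
  - by rewrite mulr_ge0// ltW.
apply: (@le_trans _ _ (\int[P]_w (al + be * X w)%:E)%E).
  apply: ge0_le_integral => //.
  - apply/measurable_EFinP; apply: measurableT_comp => //.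
    exact: measurable_funM.
  - apply/measurable_EFinP; apply: measurable_funD => //.
    exact: measurable_funM.
  - move=> w _; rewrite lee_fin (le_trans (expR_chord l B0 (XB w)))//.
    by rewrite le_eqVlt; apply/orP; left; apply/eqP; rewrite /al /be; field.
under eq_integral do rewrite EFinD (EFinM be).
rewrite integralD//=.
- by rewrite integral_cst//= probability_setT mule1 integralZl//= Xm.
- exact: finite_measure_integrable_cst.
- exact: integrableZl.
Qed.

Lemma measurable_superlevel (R : realType) (d : measure_display) (T : measurableType d)
  (f : T -> R) (c : R) : measurable_fun setT f -> measurable [set w | c <= f w].
Proof.
move=> mf; rewrite (_ : [set w | _] = f @^-1` `[c, +oo[).
  by rewrite -[X in measurable X]setTI; exact: mf.
by apply/seteqP; split => w /=; rewrite in_itv/= andbT.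
Qed.

(** Chernoff's method: the indicator of the event is dominated by a product of exponentials, whose
    integral factorizes by independence. *)
Lemma hoeffding_upper (R : realType) (d : measure_display) (T : measurableType d)
  (P : probability T R) (I : finType) (N : {set I}) (X : I -> T -> R)
  (m : I -> R) (B s : R) :
  (forall i, measurable_fun setT (X i)) -> 0 < B ->
  (forall i w, `|X i w| <= B) ->
  (forall i, \int[P]_w (X i w)%:E = (m i)%:E)%E ->
  (forall A : I -> set R, (forall i, measurable (A i)) ->
     P [set w | forall i, i \in N -> A i (X i w)] =
     (\prod_(i in N) P (X i @^-1` A i))%E) ->
  0 <= s ->
  (P [set w | (#|N|%:R * s <= \sum_(i in N) (X i w - m i))%R] <=
   (expR (- (#|N|%:R * s ^+ 2) / (2 * B ^+ 2)))%:E)%E.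
Proof.
move=> mX B0 XB Xm indep s0.
have B_neq0 : B != 0 by rewrite gt_eqF.
(* This value minimizes the exponent [- l * s + (l * B) ^+ 2 / 2], with minimum
   [- s ^+ 2 / (2 * B ^+ 2)]. *)
pose l := s / B ^+ 2.
have l0 : 0 <= l by rewrite divr_ge0// sqr_ge0.
pose f i x := expR (l * (x - m i - s)).
have mf i : measurable_fun setT (f i).
  apply: measurableT_comp => //; apply: measurable_funM => //.
  by apply: measurable_funB => //; exact: measurable_funB.
have int_f i : (\int[P]_w (f i (X i w))%:E <= (expR (- s ^+ 2 / (2 * B ^+ 2)))%:E)%E.
  have -> : (\int[P]_w (f i (X i w))%:E =
      \int[P]_w ((expR (- l * (m i + s)))%:E * (expR (l * X i w))%:E))%E.
    by apply: eq_integral => w _; rewrite -EFinM -expRD /f; congr ((expR _)%:E); ring.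
  rewrite ge0_integralZl ?lee_fin ?expR_ge0//; last first.
    by apply/measurable_EFinP; apply: measurableT_comp => //; exact: measurable_funM.
  apply: (@le_trans _ _ ((expR (- l * (m i + s)))%:E * (expR (l * m i + (l * B) ^+ 2 / 2))%:E)%E).
    by rewrite lee_pmul2l ?lte_fin ?expR_gt0//; exact: integral_expR_le.
  rewrite -EFinM lee_fin -expRD ler_expR le_eqVlt; apply/orP; left.
  by apply/eqP; rewrite /l; field.
have f0 i x : 0 <= f i x by exact: expR_ge0.
have int_f0 i : (0 <= \int[P]_w (f i (X i w))%:E)%E.
  by apply: integral_ge0 => w _; rewrite lee_fin.
have int_f_fin i : (\int[P]_w (f i (X i w))%:E)%E \is a fin_num.
  by rewrite ge0_fin_numE// (le_lt_trans (int_f i)) ?ltry.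
have mS : measurable_fun setT (fun w => \sum_(i in N) (X i w - m i)).
  under eq_fun do rewrite -big_filter.
  by apply: measurable_sum => i; exact: measurable_funB.
have mprod : measurable_fun setT (fun w => \prod_(i in N) f i (X i w)).
  under eq_fun do rewrite -big_filter.
  by apply: measurable_prod => i _; exact: measurableT_comp.
set E := [set w | _].
have mE : measurable E by exact: measurable_superlevel.
apply: (@le_trans _ _ (\int[P]_w (\prod_(i in N) f i (X i w))%:E)%E).
  rewrite -[X in P X]setIT -integral_indic//.
  apply: ge0_le_integral => //.
  - exact/measurable_EFinP.
  - exact/measurable_EFinP.
  (* On [E] the exponents of the factors add up to a nonnegative number, so the product is at least
     1; off [E] it is still nonnegative. *)
  - move=> w _; rewrite lee_fin -expR_sum -mulr_sumr big_split/= sumr_const.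
    rewrite indicE; have [wE|wE] := boolP (w \in E); last exact: expR_ge0.
    rewrite -expR0 ler_expR mulr_ge0//.
    by rewrite mulNrn subr_ge0 -mulr_natl; move: wE; rewrite inE.
rewrite (integral_prod_independent mX indep)//.
under eq_bigr do rewrite -(fineK (int_f_fin _)).
rewrite prodEFin lee_fin.
apply: (@le_trans _ _ (\prod_(i in N) expR (- s ^+ 2 / (2 * B ^+ 2)))).
  apply: ler_prod => i _; rewrite fine_ge0//=.
  by rewrite -lee_fin fineK.
rewrite prodr_const -expRM_natl ler_expR le_eqVlt; apply/orP; left.
by apply/eqP; ring.
Qed.

(** The one-sided bound is applied to [X] and to [- X], whence the factor 2; independence passes to
    [- X] by reflecting the test sets. *)
Lemma hoeffding (R : realType) (d : measure_display) (T : measurableType d)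
  (P : probability T R) (I : finType) (N : {set I}) (X : I -> T -> R)
  (m : I -> R) (B s : R) :
  (forall i, measurable_fun setT (X i)) -> 0 < B ->
  (forall i w, `|X i w| <= B) ->
  (forall i, \int[P]_w (X i w)%:E = (m i)%:E)%E ->
  (forall A : I -> set R, (forall i, measurable (A i)) ->
     P [set w | forall i, i \in N -> A i (X i w)] =
     (\prod_(i in N) P (X i @^-1` A i))%E) ->
  0 <= s ->
  (P [set w | (#|N|%:R * s <= `|\sum_(i in N) (X i w - m i)|)%R] <=
   (2 * expR (- (#|N|%:R * s ^+ 2) / (2 * B ^+ 2)))%:E)%E.
Proof.
move=> mX B0 XB Xm indep s0.
have mS : measurable_fun setT (fun w => \sum_(i in N) (X i w - m i)).
  under eq_fun do rewrite -big_filter.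
  by apply: measurable_sum => i; exact: measurable_funB.
have mS' : measurable_fun setT (fun w => \sum_(i in N) (- X i w - - m i)).
  under eq_fun do rewrite -big_filter.
  by apply: measurable_sum => i; apply: measurable_funB => //; exact: measurableT_comp.
rewrite (_ : [set w | _] = [set w | #|N|%:R * s <= \sum_(i in N) (X i w - m i)] `|`
    [set w | #|N|%:R * s <= \sum_(i in N) (- X i w - - m i)]); last first.
  apply/seteqP; split => w /=; rewrite ler_normr -sumrN;
    under [in X in _ || X]eq_bigr do rewrite opprD.
    by move=> /orP.
  by move=> /orP.
rewrite (le_trans (measureU2 _ _ _))//; do ?exact: measurable_superlevel.
rewrite mulrDl mul1r EFinD leeD//; first exact: hoeffding_upper.
apply: hoeffding_upper => //.
- by move=> i; exact: measurableT_comp.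
- by move=> i w; rewrite normrN.
- move=> i; under eq_integral do rewrite EFinN.
  rewrite integralN; first by rewrite Xm.
  by apply: integrable_add_def => //; exact: (bounded_integrable_EFin P (mX i) (XB i)).
- move=> A mA; apply: (indep (fun i => [set x | A i (- x)])) => i.
  have mN : measurable_fun setT (-%R : R -> R) by exact: oppr_measurable.
  by rewrite -[X in measurable X]setTI; exact: mN.
Qed.

(** * Laws of the features as mixtures over the labels *)

Lemma total_probability (R : realType) (d : measure_display) (T : measurableType d)
  (P : probability T R) (J : finType) (g : T -> J) (E : set T) :
  (forall j, measurable (g @^-1` [set j])) -> measurable E ->
  P E = (\sum_(j : J) P (g @^-1` [set j] `&` E))%E.
Proof.
move=> mg mE.
have {1}-> : E = \bigcup_(j in [set` index_enum J]) (g @^-1` [set j] `&` E).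
  by apply/seteqP; split => [w Ew|w [j _ []]//]; exists (g w) => //=; rewrite mem_index_enum.
rewrite measure_fin_bigcup//.
- by rewrite -fsbig_seq// index_enum_uniq.
- by move=> j k _ _ [w [[<- _] [<- _]]].
- by move=> j _; exact: measurableI.
Qed.

Section label_mixture.
Context (R : realType) (d : measure_display) (Omega : measurableType d)
  (P : probability Omega R) (V : finType) (C F : nat)
  (Y : V -> Omega -> 'I_C) (X : V -> 'I_F -> Omega -> R)
  (D : 'I_C -> 'I_F -> probability R R).
Context (mY : forall v c, measurable (Y v @^-1` [set c]))
  (mX : forall v k, measurable_fun setT (X v k))
  (condXY : forall (l : V -> 'I_C) (A : V -> 'I_F -> set R),
     (forall v k, measurable (A v k)) ->
     P (label_event Y xpredT l `&` feature_event X A) =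
     (P (label_event Y xpredT l) * \prod_(v : V) \prod_(k < F) D (l v) k (A v k))%E).

(** Packing all labels into one finite function gives a variable with values in a [finType], so that
    [total_probability] can sum over labellings. *)
Let L (w : Omega) : {ffun V -> 'I_C} := [ffun v => Y v w].

Let L_label (l : {ffun V -> 'I_C}) : L @^-1` [set l] = label_event Y xpredT l.
Proof.
apply/seteqP; split => [w <- v _|w /= h]; first by rewrite ffunE.
by apply/ffunP => v; rewrite ffunE h.
Qed.

Let measurable_label (S : pred V) (l : V -> 'I_C) : measurable (label_event Y S l).
Proof.
rewrite (_ : label_event _ _ _ = \bigcap_(v in [set v | S v]) (Y v @^-1` [set l v])).
  by apply: fin_bigcap_measurable => //; exact: finite_finset.
by apply/seteqP; split.
Qed.

Let mL l : measurable (L @^-1` [set l]).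
Proof. by rewrite L_label. Qed.

Let measurable_preimX v k (A : set R) : measurable A -> measurable (X v k @^-1` A).
Proof. by move=> mA; rewrite -[X in measurable X]setTI; exact: mX. Qed.

Lemma label_features_law (N : {set V}) (k : 'I_F) (l : V -> 'I_C) (A : V -> set R) :
  (forall v, measurable (A v)) ->
  P (label_event Y xpredT l `&` [set w | forall v, v \in N -> A v (X v k w)]) =
  (P (label_event Y xpredT l) * \prod_(v in N) D (l v) k (A v))%E.
Proof.
move=> mA.
(* Unconstrained coordinates and nodes receive [setT], which has probability 1 and drops out of the
   product. *)
pose A' v k' := if (k' == k) && (v \in N) then A v else setT.
rewrite (_ : [set w | _] = feature_event X A'); last first.
  apply/seteqP; split => w /= h.
    by move=> v k'; rewrite /A'; case: ifP => // /andP[/eqP -> ]; exact: h.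
  by move=> v vN; have := h v k; rewrite /A' eqxx vN.
rewrite condXY; last by move=> v k'; rewrite /A'; case: ifP.
congr (_ * _)%E; rewrite [RHS]big_mkcond/=; apply: eq_bigr => v _.
rewrite (bigD1 k)//= big1 ?mule1; last first.
  by move=> k' /negPf k'k; rewrite /A' k'k probability_setT.
by rewrite /A' eqxx/=; case: ifP => // _; rewrite probability_setT.
Qed.

(** Both sides are summed over all labellings: those with [l v] different from [c] contribute 0, and
    for the others [label_features_law] applies to the single node [v]. *)
Lemma label_feature_law (v : V) (k : 'I_F) (c : 'I_C) (A : set R) : measurable A ->
  P (Y v @^-1` [set c] `&` X v k @^-1` A) = (P (Y v @^-1` [set c]) * D c k A)%E.
Proof.
move=> mA.
have mXA := measurable_preimX v k mA.
rewrite (total_probability P mL (measurableI _ _ (mY v c) mXA)).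
rewrite (total_probability P mL (mY v c)) ge0_sume_distrl//.
apply: eq_bigr => l _.
have [lvc|lvc] := eqVneq (l v) c; last first.
  have e0 : L @^-1` [set l] `&` Y v @^-1` [set c] = set0.
    apply/seteqP; split => // w [/= lw Yc]; move/eqP: lvc; apply.
    by rewrite -lw ffunE.
  by rewrite setIA e0 set0I measure0 mul0e.
have sub : L @^-1` [set l] `<=` Y v @^-1` [set c].
  by move=> w /= lw; rewrite -lvc -lw ffunE.
rewrite setIA (setIidl sub) L_label.
have := @label_features_law [set v]%SET k l (fun=> A) (fun=> mA).
rewrite big_set1 lvc => <-; congr (P (_ `&` _)).
by apply/seteqP; split => w /= h; [move=> u /set1P -> | apply: h; rewrite inE].
Qed.

(** Restricted to the label event, [P] has image [q] times [D c k] under [X v k]. The transfer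
    covers nonnegative functions only, so positive and negative parts are treated separately. *)
Lemma integral_label_feature (v : V) (k : 'I_F) (c : 'I_C) (B : R) :
  (forall w, `|X v k w| <= B) ->
  (\int[P]_w (\1_(Y v @^-1` [set c]) w * X v k w)%:E =
   (fine (P (Y v @^-1` [set c])) * mean (D c k))%:E)%E.
Proof.
move=> XB.
pose q := fine (P (Y v @^-1` [set c])).
have PE : P (Y v @^-1` [set c]) = q%:E by rewrite fineK// fin_num_measure.
have q0 : 0 <= q by rewrite fine_ge0.
pose Z : Omega -> R := \1_(Y v @^-1` [set c]).
have mZ : measurable_fun setT Z by exact: measurable_indic.
have transfer (f : R -> \bar R) : measurable_fun setT f -> (forall x, 0 <= f x)%E ->
    (\int[P]_w ((Z w)%:E * f (X v k w)) = q%:E * \int[D c k]_x f x)%E.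
  move=> mf f0; rewrite -ge0_integralZl//.
  apply: (@ge0_integral_transfer R _ _ _ _ _ _ P (D c k) Z (cst q) (X v k) id) => //.
  move=> A mA.
  transitivity (P (Y v @^-1` [set c] `&` X v k @^-1` A)).
    rewrite -[X in _ = P X]setIT -integral_indic//; last first.
      by apply: measurableI => //; exact: measurable_preimX.
    by apply: eq_integral => w _; rewrite indicI.
  rewrite label_feature_law// PE.
  under eq_integral do rewrite /= EFinM.
  rewrite ge0_integralZl ?integral_indic ?setIT//.
  exact/measurable_EFinP.
have mEFin : measurable_fun setT (@EFin R) by exact/measurable_EFinP.
have mZX : measurable_fun setT (fun w => Z w * X v k w) by exact: measurable_funM.
pose ZX := EFin \o (fun w => Z w * X v k w).
have iZX : P.-integrable setT ZX.
  apply: (@bounded_integrable_EFin _ _ _ _ _ B) => // w.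
  rewrite normrM (le_trans _ (XB w))// ler_piMl// /Z indicE.
  by case: (_ \in _); rewrite ?normr1 ?normr0.
have posE : (\int[P]_w (ZX^\+ w) =
    q%:E * \int[D c k]_x ((@EFin R)^\+ x))%E.
  rewrite -transfer//; last exact: measurable_funepos.
  apply: eq_integral => w _; rewrite !funeposE /ZX/= /Z indicE.
  by case: (_ \in _); rewrite ?mul1r ?mul0r ?mul1e ?mul0e ?maxxx.
have negE : (\int[P]_w (ZX^\- w) =
    q%:E * \int[D c k]_x ((@EFin R)^\- x))%E.
  rewrite -transfer//; last exact: measurable_funeneg.
  apply: eq_integral => w _; rewrite !funenegE /ZX/= /Z indicE.
  by case: (_ \in _); rewrite ?mul1r ?mul0r ?mul1e ?mul0e ?oppr0 ?maxxx.
rewrite [LHS]integralE posE negE.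
have -> : mean (D c k) = fine (\int[D c k]_x ((@EFin R)^\+ x) - \int[D c k]_x ((@EFin R)^\- x))%E.
  by rewrite /mean unlock integralE.
have pfin := integrable_pos_fin_num measurableT iZX.
have nfin := integrable_neg_fin_num measurableT iZX.
move: pfin nfin; rewrite posE negE -/q.
(* If [q = 0] nothing is known about the moments of [D c k], but both sides vanish. Otherwise
   integrability of [ZX] forces both parts of the mean to be finite, so [fine] loses nothing. *)
have [->|qn0] := eqVneq q 0; first by rewrite !mul0e mul0r subee.
have qgt0 : 0 < q by rewrite lt_def qn0.
have finq (x : \bar R) : (q%:E * x)%E \is a fin_num -> x \is a fin_num.
  by case: x => // [|]; rewrite ?gt0_muley ?gt0_muleNy ?lte_fin.
move=> /finq + /finq.
by case: (\int[_]_x _)%E => // x _; case: (\int[_]_x _)%E => // y _; rewrite -!EFinM -EFinB/= mulrBr.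
Qed.

(** The indicators of the label events of [v] sum to 1, which splits the integral class by class. *)
Lemma integral_feature (v : V) (k : 'I_F) (B : R) :
  (forall w, `|X v k w| <= B) ->
  (\int[P]_w (X v k w)%:E =
   (\sum_(c < C) fine (P (Y v @^-1` [set c])) * mean (D c k))%:E)%E.
Proof.
move=> XB.
rewrite -sumEFin; under [RHS]eq_bigr => c _ do rewrite -(integral_label_feature c XB).
rewrite -integral_sum//=.
  apply: eq_integral => w _; rewrite sumEFin -mulr_suml; congr (_%:E).
  rewrite (bigD1 (Y v w))//= big1 ?addr0 ?indicE ?mem_set ?mul1r// => c cY.
  by rewrite indicE memNset//= => Yc; rewrite Yc eqxx in cY.
move=> c; apply: (@bounded_integrable_EFin _ _ _ _ _ B).
  by apply: measurable_funM => //; exact: measurable_indic.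
move=> w; rewrite normrM (le_trans _ (XB w))// ler_piMl// indicE.
by case: (_ \in _); rewrite ?normr1 ?normr0.
Qed.

(* Summing the conditional product law over all labellings, the sum over the labels of [N]
   factorizes since these labels are independent. *)
Lemma features_independent (N : {set V}) (k : 'I_F) (c0 : 'I_C) :
  (forall l : V -> 'I_C,
     P (label_event Y (mem N) l) = (\prod_(v in N) P (Y v @^-1` [set l v]))%E) ->
  forall A : V -> set R, (forall v, measurable (A v)) ->
  P [set w | forall v, v \in N -> A v (X v k w)] = (\prod_(v in N) P (X v k @^-1` A v))%E.
Proof.
move=> indY A mA.
have fP E : measurable E -> P E = (fine (P E))%:E.
  by move=> mE; rewrite fineK// fin_num_measure.
have fD c (E : set R) : measurable E -> D c k E = (fine (D c k E))%:E.
  by move=> mE; rewrite fineK// fin_num_measure.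
pose q v c := fine (P (Y v @^-1` [set c])).
pose M v c := fine (D c k (A v)).
have mE : measurable [set w | forall v, v \in N -> A v (X v k w)].
  rewrite (_ : [set w | _] = \bigcap_(v in [set` N]) (X v k @^-1` A v)).
    apply: fin_bigcap_measurable; first exact: finite_finset.
    by move=> v _; exact: measurable_preimX.
  by apply/seteqP; split.
have margE v : P (X v k @^-1` A v) = (\sum_(c < C) q v c * M v c)%:E.
  rewrite (total_probability P (mY v) (measurable_preimX v k (mA v))) -sumEFin.
  apply: eq_bigr => c _.
  by rewrite label_feature_law// fP// fD// -EFinM.
under [RHS]eq_bigr do rewrite margE.
rewrite prodEFin (total_probability P mL mE).
under [LHS]eq_bigr => l _.
  rewrite L_label label_features_law// fP//.
  under eq_bigr do rewrite fD//.
  rewrite prodEFin -EFinM.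
  over.
rewrite sumEFin; congr (_%:E).
(* The product of sums expands over functions equal to [c0] outside [N]. Correspondingly [rho]
   resets a labelling to [c0] outside [N], so its fibres collect the labellings that agree on
   [N]. *)
rewrite (big_distr_big c0)/=.
pose rho (l : {ffun V -> 'I_C}) : {ffun V -> 'I_C} := [ffun v => if v \in N then l v else c0].
rewrite (partition_big rho (mem (pffun_on c0 (mem N) predT)))/=; last first.
  move=> l _; apply/familyP => v; rewrite !ffunE.
  by case: ifP; rewrite !inE.
apply: eq_bigr => f fN.
have fE : fine (P (label_event Y (mem N) f)) = \prod_(v in N) q v (f v).
  rewrite indY (eq_bigr (fun v => (q v (f v))%:E)) ?prodEFin// => v _.
  by rewrite fP.
rewrite big_split/= -fE.
rewrite (total_probability P mL (measurable_label (mem N) f)).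
rewrite (eq_bigr _ (fun l _ => fP _ (measurableI _ _ (mL l) (measurable_label (mem N) f)))).
rewrite sumEFin/= mulr_suml [RHS](bigID (fun l => rho l == f))/=.
(* A labelling outside the fibre of [f] differs from [f] somewhere on [N], hence its event is
   disjoint from that of [f]. *)
rewrite [X in _ = _ + X]big1 ?addr0; last first.
  move=> l lf; rewrite (_ : _ `&` _ = set0) ?measure0 ?mul0r//.
  apply/seteqP; split => // w [/= lw fw]; move/eqP: lf; apply.
  apply/ffunP => v; rewrite -lw !ffunE; case: ifPn => vN; first exact: fw.
  by move/familyP: fN => /(_ v); rewrite (negPf vN) => /eqP.
apply: eq_bigr => l /eqP lf.
have fl v : v \in N -> f v = l v by move=> vN; rewrite -lf ffunE vN.
rewrite -L_label setIidl; last by move=> w /= lw v vN; rewrite fl// -lw ffunE.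
by congr (_ * _); apply: eq_bigr => v vN; rewrite /M fl.
Qed.

End label_mixture.

(** * From coordinates to the Euclidean norm of the mixed feature *)

(** Otherwise the [n] squares would each be below [t ^+ 2 / n] and sum to less than [t ^+ 2]. For
    [n = 0] the norm is 0, against [0 < t]. *)
Lemma exists_coord_ge (R : realType) (n : nat) (u : 'I_n -> R) (t : R) : 0 < t ->
  t <= Num.sqrt (\sum_(k < n) u k ^+ 2) -> exists k, t / Num.sqrt n%:R <= `|u k|.
Proof.
move=> t0 tu; apply/not_existsP => nu.
have {}nu k : `|u k| < t / Num.sqrt n%:R by rewrite ltNge; apply/negP.
case: n u tu nu => [|n] u tu nu.
  by move: tu; rewrite big_ord0 sqrtr0 leNgt t0.
suff : \sum_(k < n.+1) u k ^+ 2 < t ^+ 2.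
  apply/negP; rewrite -leNgt.
  rewrite -[leRHS]sqr_sqrtr; last by apply: sumr_ge0 => k _; exact: sqr_ge0.
  by rewrite lerXn2r ?nnegrE ?sqrtr_ge0// ltW.
have -> : t ^+ 2 = \sum_(k < n.+1) (t / Num.sqrt n.+1%:R) ^+ 2.
  rewrite sumr_const card_ord -[RHS]mulr_natr exprMn exprVn sqr_sqrtr// mulfVK//.
apply: ltr_sum; first by apply/hasP; exists ord0; rewrite ?mem_index_enum.
by move=> k _; rewrite -real_normK ?num_real// ltrXn2r ?nnegrE.
Qed.

Lemma finite_union_bound (R : realType) (d : measure_display) (T : measurableType d)
  (P : {measure set T -> \bar R}) (J : finType) (E : set T) (A : J -> set T) :
  measurable E -> (forall j, measurable (A j)) -> (E `<=` \bigcup_j A j) ->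
  (P E <= \sum_(j : J) P (A j))%E.
Proof.
move=> mE mA EA; rewrite fsbig_seq ?index_enum_uniq//.
apply: content_sub_fsum => //.
by move=> w /EA[j _ Aj]; exists j => //=; rewrite mem_index_enum.
Qed.

Theorem theorem1
  (R : realType) (dO : measure_display) (Omega : measurableType dO)
  (P : probability Omega R)
  (V : finType) (e : rel V) (C F : nat)
  (Y : V -> Omega -> 'I_C) (X : V -> 'I_F -> Omega -> R)
  (Yhat : V -> 'I_C -> Omega -> R)
  (D : 'I_C -> 'I_F -> probability R R)
  (B p : R) (i : V) (yi : 'I_C) :
  (* finite simple graph, every degree >= 1, C >= 2 classes *)
  (forall u v, e u v = e v u) -> (forall v, ~~ e v v) ->
  (forall v, (0 < deg e v)%N) -> (2 <= C)%N ->
  (* measurability of the random variables *)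
  (forall v c, measurable (Y v @^-1` [set c])) ->
  (forall v k, measurable_fun setT (X v k)) ->
  (forall v c, measurable_fun setT (Yhat v c)) ->
  (* conditioning on y_i: the label of node i is yi *)
  (forall w, Y i w = yi) ->
  (* (1)+(2): given the labels, the features of distinct nodes are independent,
     x_v ~ D_{y_v}, and D_c has independent coordinates with laws D c k *)
  (forall (l : V -> 'I_C) (A : V -> 'I_F -> set R),
     (forall v k, measurable (A v k)) ->
     P (label_event Y xpredT l `&` feature_event X A) =
     (P (label_event Y xpredT l) * \prod_(v : V) \prod_(k < F) D (l v) k (A v k))%E) ->
  (* (3) bounded features *)
  0 < B -> (forall v k w, `|X v k w| <= B) ->
  (* (4) pseudo-labels: E[yhat_v | y_v = c] = (1-eps) e_c + eps/(C-1) sum_{c'<>c} e_c' *)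
  (forall v, exists2 eps : R, 0 < eps < 1 &
     forall c c', (\int[P]_(w in [set w | Y v w = c]) (Yhat v c' w)%:E =
       P [set w | Y v w = c] *
       (if c' == c then 1 - eps else eps / (C.-1)%:R)%:E)%E) ->
  (* (5) neighbour labels: independent, with the given marginals *)
  (forall j, e i j ->
     P [set w | Y j w = yi] = p%:E /\
     forall c, c != yi -> P [set w | Y j w = c] = ((1 - p) / (C.-1)%:R)%:E) ->
  (forall l : V -> 'I_C,
     P (label_event Y (e i) l) = (\prod_(j in nbhd e i) P [set w | Y j w = l j])%E) ->
  (* conclusions *)
  (forall k : 'I_F,
     ('E_P[fun w => mixup e X i w k] =
      (p * mean (D yi k) + (1 - p) / (C.-1)%:R * \sum_(c < C | c != yi) mean (D c k))%:E)%E)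
  /\
  (forall t : R, 0 < t ->
     (P [set w | (t <= Num.sqrt (\sum_(k < F)
            (mixup e X i w k - fine ('E_P[fun w' => mixup e X i w' k])%E) ^+ 2))%R]
      <= (2 * F%:R * expR (- ((deg e i)%:R * t ^+ 2) / (2 * B ^+ 2 * F%:R)))%:E)%E).


Proof.
move=> e_sym e_irr deg_gt0 C2 mY mX _ Yi condXY B0 XB _ Yq indY.
pose N := nbhd e i.
have n0 : (deg e i)%:R != 0 :> R by rewrite pnatr_eq0 -lt0n.
have NE j : (j \in N) = e i j by rewrite inE.
pose m k := p * mean (D yi k) + (1 - p) / (C.-1)%:R * \sum_(c < C | c != yi) mean (D c k).
(* [hoeffding] asks for the mean at every node, while the label law is prescribed only at neighbours
   of [i]. Hence the general mixture mean [mu], which equals [m] on [N]. *)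
pose mu k v := \sum_(c < C) fine (P (Y v @^-1` [set c])) * mean (D c k).
have intX v k : (\int[P]_w (X v k w)%:E = (mu k v)%:E)%E.
  exact: (integral_feature mY mX condXY (XB v k)).
have muE k v : v \in N -> mu k v = m k.
  rewrite NE => /Yq[Pyi Pc]; rewrite /mu (bigD1 yi)//= Pyi/=; congr (_ + _).
  by rewrite mulr_sumr; apply: eq_bigr => c cyi; rewrite Pc.
have mixE k : ('E_P[fun w => mixup e X i w k] = (m k)%:E)%E.
  rewrite unlock /mixup; under eq_integral do rewrite -sumEFin.
  rewrite integral_sum//=; last first.
    move=> v; apply: (@bounded_integrable_EFin _ _ _ _ _ ((deg e i)%:R^-1 * B)).
      exact: measurable_funM.
    by move=> w; rewrite normrM ger0_norm ?invr_ge0// ler_wpM2l ?invr_ge0.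
  rewrite (eq_bigr (fun=> ((deg e i)%:R^-1 * m k)%:E)); last first.
    move=> v vN; under eq_integral do rewrite EFinM.
    rewrite integralZl//=; last exact: (bounded_integrable_EFin P (mX v k) (XB v k)).
    by rewrite intX muE.
  by rewrite sumEFin sumr_const -[X in X%:E = _]mulr_natr mulrAC mulVf// mul1r.
split; first exact: mixE.
move=> t t0.
have mixB k w : mixup e X i w k - m k = (deg e i)%:R^-1 * \sum_(v in N) (X v k w - mu k v).
  rewrite /mixup -/N -mulr_sumr sumrB mulrBr; congr (_ - _).
  rewrite (eq_bigr (fun=> m k)); last by move=> v; exact: muE.
  by rewrite sumr_const -[X in _ * X]mulr_natl mulrA mulVf// mul1r.
have mmix k : measurable_fun setT (fun w => mixup e X i w k).
  rewrite /mixup; under eq_fun do rewrite -big_filter.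
  by apply: measurable_sum => v; exact: measurable_funM.
under eq_set => w do under eq_bigr => k _ do rewrite mixE/=.
pose s := t / Num.sqrt F%:R.
pose b : R := 2 * expR (- ((deg e i)%:R * s ^+ 2) / (2 * B ^+ 2)).
pose A (k : 'I_F) := [set w | (deg e i)%:R * s <= `|\sum_(v in N) (X v k w - mu k v)|].
have s0 : 0 <= s by rewrite divr_ge0 ?sqrtr_ge0// ltW.
have Ab k : (P (A k) <= b%:E)%E.
  apply: (hoeffding (X := fun v => X v k)) => //.
  (* The class [yi] merely serves as the default label outside the neighbourhood. *)
  apply: (features_independent mY mX condXY k yi) => l.
  rewrite -indY; congr (P _); apply/seteqP; split => w /= h v; have := h v; rewrite /= NE; exact.
apply: (@le_trans _ _ (\sum_(k < F) b%:E)%E).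
  rewrite (le_trans _ (lee_sum _ (fun k _ => Ab k)))//.
  apply: finite_union_bound.
  - rewrite (_ : [set w | _] = [set w | t <= Num.sqrt (\sum_(k < F) (mixup e X i w k - m k) ^+ 2)])//.
    apply: measurable_superlevel.
    apply: measurableT_comp.
      by apply: continuous_measurable_fun; exact: sqrt_continuous.
    apply: measurable_sum => k; apply: measurable_funX.
    exact: measurable_funB.
  - move=> k; apply: measurable_superlevel; apply: measurableT_comp => //.
    under eq_fun do rewrite -big_filter.
    by apply: measurable_sum => v; exact: measurable_funB.
  - move=> w /= /(exists_coord_ge t0)[k]; rewrite mixB => h; exists k => //=.
    by rewrite /A/= mulrC -ler_pdivlMr ?ltr0n// mulrC -[X in X * _]ger0_norm ?invr_ge0// -normrM.
rewrite sumEFin sumr_const card_ord lee_fin -[leLHS]mulr_natl.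
rewrite le_eqVlt; apply/orP; left; apply/eqP; rewrite /b.
(* For [F = 0] both bounds are 0; otherwise [s ^+ 2 = t ^+ 2 / F] turns the sum of the coordinate
   bounds into the stated one. *)
have [->|F0] := eqVneq F 0%N; first by rewrite !mul0r mulr0 mul0r.
have FR0 : F%:R != 0 :> R by rewrite pnatr_eq0.
rewrite mulrCA mulrA; congr (_ * expR _).
rewrite /s exprMn exprVn sqr_sqrtr//; field.
by rewrite FR0 gt_eqF.
Qed.
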